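(* Let $T>0$, $Q>0$, and let $\theta,\eta:[0,T]\to(0,\infty)$ be continuously differentiable. Let $\bar\eta=\min_{0\le t\le T}\eta_t$, $\bar\theta=\max_{0\le t\le T}\max\{-\dot\theta_t,0\}$ and $\gamma=\frac{\bar\theta}{2\bar\eta}$. Assume that the Optimal Execution Problem of maximizing $\mathcal{J}$ over $\Xi(Q)$ has a unique solution. If $\sqrt{\gamma}\,T<\pi$, then the optimal solution $\zeta$ is non-negative on $[0,T]$.
   Context: $\Xi(Q)=\{\zeta\in\mathcal{C}^2([0,T]):\ \zeta_0=Q,\ \zeta_T=0\}$ and $$\mathcal{J}(\zeta)=\int_0^T\left(\theta_t\,\dot\zeta_t\,\zeta_t-\eta_t\,\dot\zeta_t^2\right)dt .$$ An optimal solution necessarily solves the Euler–Lagrange boundary value problem $2\eta_t\ddot\zeta_t+2\dot\eta_t\dot\zeta_t-\dot\theta_t\zeta_t=0$, $\zeta_0=Q$, $\zeta_T=0$. *)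

(* Defs.v *)
From Stdlib Require Import Reals Lra.
From Coquelicot Require Import Coquelicot.
Open Scope R_scope.

Definition Icc (a b : R) (t : R) : Prop := a <= t <= b.

(* Coquelicot's [is_derive] with the filter of neighbourhoods relative to [D],
   i.e. one-sided derivatives at the endpoints of a closed interval. *)
Definition is_derive_on (D : R -> Prop) (f : R -> R) (t l : R) : Prop :=
  filterdiff f (within D (locally t)) (fun y : R => scal y l).

(* Total, like Coquelicot's [Derive]: unspecified where [f] is not
   differentiable relative to [D]. *)
Definition Derive_on (D : R -> Prop) (f : R -> R) (t : R) : R :=
  iota (is_derive_on D f t).

Fixpoint class_C (k : nat) (D : R -> Prop) (f : R -> R) : Prop :=
  match k with
  | O => continuous_on D f
  | S k' => (forall t, D t -> exists l, is_derive_on D f t l) /\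
            class_C k' D (Derive_on D f)
  end.

Definition is_min_on (D : R -> Prop) (f : R -> R) (m : R) : Prop :=
  (exists t, D t /\ f t = m) /\ (forall t, D t -> m <= f t).

Definition is_max_on (D : R -> Prop) (f : R -> R) (m : R) : Prop :=
  (exists t, D t /\ f t = m) /\ (forall t, D t -> f t <= m).

Definition Xi (T Q : R) (zeta : R -> R) : Prop :=
  class_C 2 (Icc 0 T) zeta /\ zeta 0 = Q /\ zeta T = 0.

Definition J (T : R) (theta eta zeta : R -> R) : R :=
  let dzeta := Derive_on (Icc 0 T) zeta in
  RInt (fun t => theta t * dzeta t * zeta t - eta t * (dzeta t) ^ 2) 0 T.

Definition is_optimal (T Q : R) (theta eta zeta : R -> R) : Prop :=
  Xi T Q zeta /\
  forall xi, Xi T Q xi -> J T theta eta xi <= J T theta eta zeta.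

(* Strategies are functions on [0,T]; their values elsewhere are irrelevant, so
   uniqueness means equality on [0,T]. *)
Definition has_unique_optimum (T Q : R) (theta eta : R -> R) : Prop :=
  exists zeta, is_optimal T Q theta eta zeta /\
    forall xi, is_optimal T Q theta eta xi ->
      forall t, Icc 0 T t -> xi t = zeta t.

Lemma is_derive_on_unique (a b : R) (f : R -> R) (t l1 l2 : R) :
  a < b -> Icc a b t ->
  is_derive_on (Icc a b) f t l1 -> is_derive_on (Icc a b) f t l2 -> l1 = l2.
Proof.
intros Hab Ht [_ H1] [_ H2].
assert (Hlim : is_filter_lim (within (Icc a b) (locally t)) t).
{ intros P HP; unfold within; revert HP; apply filter_imp; auto. }
destruct (Req_dec l1 l2) as [E | N]; [exact E | exfalso].
assert (He : 0 < Rabs (l1 - l2) / 4).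
{ assert (0 < Rabs (l1 - l2)) by (apply Rabs_pos_lt; lra). lra. }
destruct (H1 t Hlim (mkposreal _ He)) as [d1 K1].
destruct (H2 t Hlim (mkposreal _ He)) as [d2 K2].
assert (Hy : exists y, Icc a b y /\ y <> t /\ Rabs (y - t) < d1 /\ Rabs (y - t) < d2).
{ set (d := Rmin (Rmin d1 d2) (b - a) / 2).
  assert (0 < d /\ d < d1 /\ d < d2 /\ d <= (b - a) / 2).
  { unfold d; destruct d1 as [d1 P1], d2 as [d2 P2]; simpl.
    unfold Rmin; repeat destruct Rle_dec; lra. }
  unfold Icc in *.
  destruct (Rle_dec t ((a + b) / 2)).
  - exists (t + d). replace (t + d - t) with d by ring.
    rewrite Rabs_pos_eq by lra. lra.
  - exists (t - d). replace (t - d - t) with (- d) by ring.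
    rewrite Rabs_Ropp, Rabs_pos_eq by lra. lra. }
destruct Hy as (y & Iy & Ny & B1 & B2).
specialize (K1 y B1 Iy). specialize (K2 y B2 Iy). simpl in K1, K2.
unfold norm, minus, plus, opp, scal in K1, K2; simpl in K1, K2.
unfold abs, mult in K1, K2; simpl in K1, K2.
fold (y - t) in K1, K2.
assert (P : 0 < Rabs (y - t)) by (apply Rabs_pos_lt; lra).
assert (Q : Rabs (l1 - l2) * Rabs (y - t) <= Rabs (l1 - l2) / 2 * Rabs (y - t)).
{ rewrite <- Rabs_mult.
  replace ((l1 - l2) * (y - t)) with
    ((f y + - f t + - ((y - t) * l2)) - (f y + - f t + - ((y - t) * l1))) by ring.
  eapply Rle_trans; [apply Rabs_triang|]. rewrite Rabs_Ropp. lra. }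
apply Rmult_le_reg_r in Q; lra.
Qed.

Lemma Derive_on_eq (a b : R) (f : R -> R) (t l : R) :
  a < b -> Icc a b t ->
  is_derive_on (Icc a b) f t l -> Derive_on (Icc a b) f t = l.
Proof.
intros Hab Ht H; apply (@iota_unique R_AbsRing R_CompleteNormedModule); [intros y Hy | exact H].
exact (is_derive_on_unique a b f t y l Hab Ht Hy H).
Qed.

(* Main.v *)
Require Import Defs.
From Stdlib Require Import Reals Lra.
From Coquelicot Require Import Coquelicot.
Open Scope R_scope.

(** If [zeta] were negative somewhere, it would vanish at some [0 < a < T] and at
    [T] without vanishing identically on [[a, T]].  Du Bois-Reymond's choice of
    test function (the primitive of [W] minus its mean, where
    [W = theta zeta - 2 eta zeta' - int theta zeta']) yields the Euler-Lagrange
    equation [2 (eta zeta')' = theta' zeta] on [(0, T)].  With [k = sqrt gamma] and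
    [s / c = tan (k (t - T / 2))], finite on [[0, T]] because [k T < PI], Picone's
    function [F = eta zeta zeta' + eta_bar k (s / c) zeta^2] is then nondecreasing
    on [[a, T]] and vanishes at both ends, so [F' = 0].  This forces
    [(zeta / c)' = 0], hence [zeta = 0] on [[a, T]]. *)

(** * Continuity and derivatives by computation *)

Ltac continuity_tac :=
  repeat match goal with
  | H : forall t, is_derive ?f t _ |- continuous ?f ?x =>
      apply (ex_derive_continuous f x); eexists; apply H
  | H : forall t, continuous ?f t |- continuous ?f ?x => apply H
  | |- continuous (fun _ => ?c) _ => apply continuous_const
  | |- continuous (fun x => @?f x + @?g x) _ => apply (continuous_plus f g)
  | |- continuous (fun x => @?f x - @?g x) _ => apply (continuous_minus f g)
  | |- continuous (fun x => @?f x * @?g x) _ => apply (continuous_mult f g)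
  end.

Ltac derive_tac :=
  auto_derive;
  [ repeat split; (apply Rgt_not_eq; assumption) || (eexists; eauto)
  | repeat match goal with
    | H : forall t, is_derive ?f t _ |- _ =>
        rewrite (fun t => is_derive_unique (fun x : R => f x) t _ (H t))
    end ].

(** * Monotonicity from the sign of the derivative *)

Lemma nonneg_derivative_le (f df : R -> R) (a b : R) :
  a <= b ->
  (forall x, a < x < b -> is_derive f x (df x)) ->
  (forall x, a < x < b -> 0 <= df x) ->
  (forall x, a <= x <= b -> continuous f x) ->
  f a <= f b.
Proof.
intros Hab Hd Hp Hc.
(* [MVT_gen] may return an endpoint, where [df] has no known sign. *)
destruct (MVT_gen f a b (fun x => Rmax (df x) 0)) as (c & _ & Hc').
- rewrite Rmin_left, Rmax_right by lra. intros x Hx.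
  rewrite Rmax_left by (apply Hp; lra). apply Hd; lra.
- rewrite Rmin_left, Rmax_right by lra. intros x Hx.
  apply continuity_pt_filterlim, Hc; lra.
- assert (0 <= Rmax (df c) 0 * (b - a)).
  { apply Rmult_le_pos; [apply Rmax_r | lra]. }
  lra.
Qed.

Lemma zero_derivative_eq (f : R -> R) (a b : R) :
  a <= b ->
  (forall x, a < x < b -> is_derive f x 0) ->
  (forall x, a <= x <= b -> continuous f x) ->
  f a = f b.
Proof.
intros Hab Hd Hc. apply Rle_antisym.
- apply (nonneg_derivative_le f (fun _ => 0)); auto. intros; lra.
- apply Ropp_le_cancel.
  apply (nonneg_derivative_le (fun x => - f x) (fun _ => 0)); auto.
  + intros x Hx. replace 0 with (opp 0) by exact Ropp_0.
    apply (is_derive_opp f). auto.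
  + intros; lra.
  + intros x Hx. apply (continuous_opp f). auto.
Qed.

Lemma is_derive_open_const (f : R -> R) (a b t c l : R) :
  a < t < b -> (forall x, a < x < b -> f x = c) -> is_derive f t l -> l = 0.
Proof.
intros Ht Hf Hd.
rewrite <- (is_derive_unique _ _ _ Hd).
apply is_derive_unique, (is_derive_ext_loc (fun _ => c)).
- apply (locally_interval _ t (Finite a) (Finite b)); simpl; try apply Ht.
  intros y H1 H2; symmetry; apply Hf; split; assumption.
- apply (@is_derive_const R_AbsRing).
Qed.

(** Monotonicity squeezes [f] between its two equal end values, so [f] is constant in between. *)
Lemma nonneg_derivative_zero (f df : R -> R) (a b : R) :
  (forall x, a < x < b -> is_derive f x (df x)) ->
  (forall x, a < x < b -> 0 <= df x) ->
  (forall x, a <= x <= b -> continuous f x) ->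
  f a = f b ->
  forall t, a < t < b -> df t = 0.
Proof.
intros Hd Hp Hc E t Ht.
apply (is_derive_open_const f a b t (f a)); auto.
intros x Hx. apply Rle_antisym.
- rewrite E. apply (nonneg_derivative_le f df); try lra; intros;
    (apply Hd || apply Hp || apply Hc); lra.
- apply (nonneg_derivative_le f df); try lra; intros;
    (apply Hd || apply Hp || apply Hc); lra.
Qed.

(** * Relative derivatives versus two-sided derivatives *)

(** [filterdiff] demands its estimate at every limit point of the filter; this reduces the demand to
    [t] itself. A ball around [x] of radius [Rabs (t - x)] would otherwise have to contain [t]. *)
Lemma is_filter_lim_within (D : R -> Prop) (t x : R) :
  D t -> is_filter_lim (within D (locally t)) x -> x = t.
Proof.
intros Dt H.
destruct (Req_dec x t) as [E | N]; [exact E | exfalso].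
assert (P : 0 < Rabs (t - x)) by (apply Rabs_pos_lt; lra).
assert (L : within D (locally t) (ball x (mkposreal _ P))).
{ apply H, locally_ball. }
apply locally_singleton in L. specialize (L Dt).
unfold ball in L; simpl in L; unfold AbsRing_ball, abs, minus, plus, opp in L;
  simpl in L. unfold Rminus in L. lra.
Qed.

Lemma is_derive_is_derive_on (D : R -> Prop) (f g : R -> R) (t l : R) :
  D t -> (forall s, D s -> f s = g s) -> is_derive g t l -> is_derive_on D f t l.
Proof.
intros Dt E [L H]. split; [exact L |].
intros x Hx eps. apply is_filter_lim_within in Hx; [subst x | exact Dt].
specialize (H t (fun P HP => HP) eps).
unfold within; revert H; apply filter_imp; intros y Hy Dy.
rewrite (E y Dy), (E t Dt). exact Hy.
Qed.

Lemma is_derive_on_is_derive (D : R -> Prop) (f : R -> R) (t l : R) :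
  locally t D -> is_derive_on D f t l -> is_derive f t l.
Proof.
intros LD [L H]. split; [exact L |].
intros x Hx eps.
assert (Hx' : is_filter_lim (within D (locally t)) x).
{ intros P HP. apply filter_le_within, Hx, HP. }
specialize (H x Hx' eps).
generalize (filter_and _ _ LD H); apply filter_imp.
intros y [Dy Hy]. exact (Hy Dy).
Qed.

Lemma is_derive_on_continuous_on (D : R -> Prop) (f : R -> R) :
  (forall t, D t -> exists l, is_derive_on D f t l) -> continuous_on D f.
Proof.
intros H t Dt. destruct (H t Dt) as [l Hl].
apply (@filterdiff_continuous_aux _ R_NormedModule R_NormedModule).
- apply within_filter, locally_filter.
- eexists; exact Hl.
- intros P HP. apply filter_le_within, HP.
Qed.

(** * Extension of smooth functions from an interval to the line *)

(** For [a <= b], the nearest-point projection onto the interval; composing with it extends a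
    function by its end values. *)
Definition clamp (a b t : R) : R := Rmax a (Rmin b t).

Lemma clamp_in (a b t : R) : a <= b -> Icc a b (clamp a b t).
Proof.
intros; unfold clamp, Icc, Rmax, Rmin; repeat destruct Rle_dec; lra.
Qed.

Lemma clamp_id (a b t : R) : Icc a b t -> clamp a b t = t.
Proof.
unfold clamp, Icc, Rmax, Rmin; intros; repeat destruct Rle_dec; lra.
Qed.

Lemma continuous_on_clamp (a b : R) (f : R -> R) :
  a <= b -> continuous_on (Icc a b) f ->
  forall t, continuous (fun s => f (clamp a b s)) t.
Proof.
intros Hab Hf t.
apply (filterlim_comp _ _ _ (clamp a b) f _
  (within (Icc a b) (locally (clamp a b t)))).
(* The projection is 1-Lipschitz, so the same radius [e] serves. *)
- intros P [e He]. exists e. intros y Hy. apply He; [| apply clamp_in, Hab].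
  unfold ball in *; simpl in *; unfold AbsRing_ball, abs, minus, plus, opp in *;
    simpl in *.
  apply Rle_lt_trans with (2 := Hy).
  unfold clamp, Rmax, Rmin, Rabs; repeat destruct Rle_dec;
    repeat destruct Rcase_abs; lra.
- apply Hf, clamp_in, Hab.
Qed.

Lemma is_derive_primitive (phi : R -> R) (a c : R) :
  (forall t, continuous phi t) ->
  forall t, is_derive (fun s => c + RInt phi a s) t (phi t).
Proof.
intros Hphi t.
replace (phi t) with (plus 0 (phi t)) by exact (Rplus_0_l _).
apply (is_derive_plus (fun _ => c)).
- apply (@is_derive_const R_AbsRing).
- apply (is_derive_RInt _ _ a); [| apply Hphi].
  apply filter_forall; intros s. apply (RInt_correct phi).
  apply (ex_RInt_continuous phi); auto.
Qed.

Lemma extend_primitive (a b : R) (f phi : R -> R) :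
  a <= b ->
  (forall t, Icc a b t -> is_derive_on (Icc a b) f t (phi t)) ->
  (forall t, continuous phi t) ->
  exists g, (forall t, is_derive g t (phi t)) /\
    forall t, Icc a b t -> g t = f t.
Proof.
intros Hab Hd Hphi.
set (g := fun s => f a + RInt phi a s).
assert (Hg : forall t, is_derive g t (phi t)).
{ intros t; apply is_derive_primitive, Hphi. }
exists g. split; [exact Hg |].
intros t Ht.
(* Outside the interval [f] is arbitrary and may fail to be continuous at the endpoints in the
   two-sided sense; [g] is therefore compared with the clamped [f]. *)
assert (Hf : forall t, continuous (fun s => f (clamp a b s)) t).
{ apply continuous_on_clamp; auto. apply is_derive_on_continuous_on. eauto. }
assert (E : g a - f (clamp a b a) = g t - f (clamp a b t)).
{ apply (zero_derivative_eq (fun s => g s - f (clamp a b s))).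
  - apply Ht.
  - intros x Hx. destruct Ht as [Ht1 Ht2].
    replace 0 with (minus (phi x) (phi x)) by exact (Rminus_diag _).
    apply (is_derive_minus g); [apply Hg |].
    assert (Lx : locally x (Icc a b)).
    { apply (locally_interval _ x (Finite a) (Finite b)); simpl; try lra.
      unfold Icc; intros y; simpl; lra. }
    apply (is_derive_ext_loc f).
    + revert Lx; apply filter_imp; intros y Hy. rewrite clamp_id; auto.
    + apply (is_derive_on_is_derive (Icc a b)); auto.
      apply Hd; unfold Icc; lra.
  - intros x _. continuity_tac. }
rewrite !clamp_id in E by (auto; unfold Icc; lra).
unfold g in E at 1. rewrite RInt_point in E.
unfold zero in E; simpl in E. lra.
Qed.

(** The derivative is continued by constants beyond the endpoints, and [f] by integrating it, hence
    affinely. *)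
Lemma class_C1_extend (a b : R) (f : R -> R) :
  a < b -> class_C 1 (Icc a b) f ->
  exists g g', (forall t, is_derive g t (g' t)) /\ (forall t, continuous g' t) /\
    forall t, Icc a b t -> g t = f t /\ g' t = Derive_on (Icc a b) f t.
Proof.
intros Hab [Hd Hc].
set (g' := fun t => Derive_on (Icc a b) f (clamp a b t)).
assert (Hg' : forall t, continuous g' t).
{ apply continuous_on_clamp; [lra | exact Hc]. }
destruct (extend_primitive a b f g') as (g & Hg & E); [lra | | exact Hg' |].
- intros t Ht. unfold g'. rewrite clamp_id by exact Ht.
  destruct (Hd t Ht) as [l Hl]. rewrite (Derive_on_eq a b f t l); auto.
- exists g, g'. split; [exact Hg | split; [exact Hg' |]].
  intros t Ht. split; [exact (E t Ht) |]. unfold g'; rewrite clamp_id; auto.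
Qed.

(** The previous extension is applied to the derivative of [f] and integrated once more. *)
Lemma class_C2_extend (a b : R) (f : R -> R) :
  a < b -> class_C 2 (Icc a b) f ->
  exists g g' g'', (forall t, is_derive g t (g' t)) /\
    (forall t, is_derive g' t (g'' t)) /\ (forall t, continuous g'' t) /\
    forall t, Icc a b t -> g t = f t /\ g' t = Derive_on (Icc a b) f t.
Proof.
intros Hab [Hd Hc].
destruct (class_C1_extend a b _ Hab Hc) as (g' & g'' & H1 & H2 & H3).
destruct (extend_primitive a b f g') as (g & Hg & E); [lra | | |].
- intros t Ht. rewrite (proj1 (H3 t Ht)).
  destruct (Hd t Ht) as [l Hl]. rewrite (Derive_on_eq a b f t l); auto.
- intros t. continuity_tac.
- exists g, g', g''. split; [exact Hg | split; [exact H1 | split; [exact H2 |]]].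
  intros t Ht. split; [exact (E t Ht) | apply H3, Ht].
Qed.

Lemma Derive_on_ext_is_derive (a b : R) (f g : R -> R) (t l : R) :
  a < b -> Icc a b t -> (forall s, Icc a b s -> f s = g s) ->
  is_derive g t l -> Derive_on (Icc a b) f t = l.
Proof.
intros Hab Ht E Hg. apply Derive_on_eq; auto.
exact (is_derive_is_derive_on _ f g t l Ht E Hg).
Qed.

(** Serves to show that perturbations of the optimum lie in [Xi]. *)
Lemma is_derive_class_C2 (a b : R) (g g' g'' : R -> R) :
  a < b -> (forall t, is_derive g t (g' t)) -> (forall t, is_derive g' t (g'' t)) ->
  (forall t, continuous g'' t) -> class_C 2 (Icc a b) g.
Proof.
intros Hab H1 H2 H3.
assert (E1 : forall t, Icc a b t -> Derive_on (Icc a b) g t = g' t).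
{ intros t Ht. apply (Derive_on_ext_is_derive a b g g); auto. }
assert (E2 : forall t, Icc a b t ->
  Derive_on (Icc a b) (Derive_on (Icc a b) g) t = g'' t).
{ intros t Ht. apply (Derive_on_ext_is_derive a b _ g'); auto. }
split; [| split].
- intros t Ht. exists (g' t). apply (is_derive_is_derive_on _ g g); auto.
- intros t Ht. exists (g'' t). apply (is_derive_is_derive_on _ _ g'); auto.
- intros t Ht. rewrite (E2 t Ht).
  apply (filterlim_within_ext _ g''); [intros s Hs; symmetry; auto |].
  apply filterlim_filter_le_1 with (2 := H3 t). apply filter_le_within.
Qed.

(** * First variation and the Euler-Lagrange equation *)

Lemma ex_RInt_cont (f : R -> R) (a b : R) :
  (forall t, continuous f t) -> ex_RInt f a b.
Proof. intros H; apply (ex_RInt_continuous f); auto. Qed.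

Lemma linear_coefficient_zero (A B : R) :
  (forall e, e * A + e ^ 2 * B <= 0) -> A = 0.
Proof.
intros H.
destruct (Req_dec A 0) as [E | N]; [exact E | exfalso].
set (M := Rabs B + 1).
assert (HM : 0 < M) by (unfold M; pose proof (Rabs_pos B); lra).
assert (HB : - B < M) by (unfold M; pose proof (Rle_abs (- B)); rewrite Rabs_Ropp in *; lra).
(* For [e = A / M] the left side equals [e ^ 2 * (M + B)], which is positive since [M + B > 0]. *)
specialize (H (A / M)).
assert (P : 0 < (A / M) ^ 2).
{ apply pow2_gt_0. unfold Rdiv. apply Rmult_integral_contrapositive_currified;
    [exact N | apply Rinv_neq_0_compat; lra]. }
replace (A / M * A) with ((A / M) ^ 2 * M) in H by (field; lra).
nra.
Qed.

Section EulerLagrange.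

(* [th], [et], [z] extend [theta], [eta], [zeta] to the whole line, so that only
   two-sided derivatives occur. *)
Variables (T Q : R) (theta eta zeta : R -> R).
Variables (th th' et et' z z' z'' : R -> R).
Hypothesis T_pos : 0 < T.
Hypothesis dth : forall t, is_derive th t (th' t).
Hypothesis cth : forall t, continuous th' t.
Hypothesis det : forall t, is_derive et t (et' t).
Hypothesis cet : forall t, continuous et' t.
Hypothesis dz : forall t, is_derive z t (z' t).
Hypothesis dz' : forall t, is_derive z' t (z'' t).
Hypothesis cz : forall t, continuous z'' t.
Hypothesis Eth : forall t, Icc 0 T t -> th t = theta t.
Hypothesis Eet : forall t, Icc 0 T t -> et t = eta t.
Hypothesis Ez : forall t, Icc 0 T t -> z t = zeta t.
Hypothesis opt : is_optimal T Q theta eta zeta.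

Lemma J_extend (xi x x' : R -> R) :
  (forall t, Icc 0 T t -> xi t = x t) -> (forall t, is_derive x t (x' t)) ->
  J T theta eta xi = RInt (fun t => th t * x' t * x t - et t * x' t ^ 2) 0 T.
Proof.
intros E H. apply (RInt_ext (V := R_CompleteNormedModule)).
rewrite Rmin_left, Rmax_right by lra. intros t Ht.
assert (It : Icc 0 T t) by (unfold Icc; lra).
rewrite (Derive_on_ext_is_derive 0 T xi x t (x' t)), E, Eth, Eet; auto.
Qed.

(** The functional is quadratic, so its value at [z + e h] is exactly a polynomial of degree two in
    [e], with coefficients the integrals of [f0], [f1], [f2]. Optimality bounds it by its value at
    [e = 0], which kills the linear coefficient. *)
Lemma first_variation_zero (h h' h'' : R -> R) :
  (forall t, is_derive h t (h' t)) -> (forall t, is_derive h' t (h'' t)) ->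
  (forall t, continuous h'' t) -> h 0 = 0 -> h T = 0 ->
  RInt (fun t => th t * z' t * h t + (th t * z t - 2 * et t * z' t) * h' t) 0 T = 0.
Proof.
intros dh dh' ch h0 hT.
destruct opt as [[_ [Z0 ZT]] Hopt].
set (f0 := fun t => th t * z' t * z t - et t * (z' t * z' t)).
set (f1 := fun t => th t * z' t * h t + (th t * z t - 2 * et t * z' t) * h' t).
set (f2 := fun t => th t * h' t * h t - et t * (h' t * h' t)).
assert (I0 : ex_RInt f0 0 T) by (apply ex_RInt_cont; intros; unfold f0; continuity_tac).
assert (I1 : ex_RInt f1 0 T) by (apply ex_RInt_cont; intros; unfold f1; continuity_tac).
assert (I2 : ex_RInt f2 0 T) by (apply ex_RInt_cont; intros; unfold f2; continuity_tac).
apply (linear_coefficient_zero _ (RInt f2 0 T)). intros e. fold f1.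
set (x := fun t => z t + e * h t).
set (x' := fun t => z' t + e * h' t).
assert (dx : forall t, is_derive x t (x' t)).
{ intros t. unfold x, x'. derive_tac; ring. }
assert (dx' : forall t, is_derive x' t (z'' t + e * h'' t)).
{ intros t. unfold x'. derive_tac; ring. }
assert (Xix : Xi T Q x).
{ split; [| split].
  - apply (is_derive_class_C2 0 T x x' (fun t => z'' t + e * h'' t)); auto.
    intros t; continuity_tac.
  - unfold x. rewrite h0, Ez, Z0 by (unfold Icc; lra). ring.
  - unfold x. rewrite hT, Ez, ZT by (unfold Icc; lra). ring. }
specialize (Hopt x Xix).
rewrite (J_extend x x x'), (J_extend zeta z z') in Hopt by
  (auto; intros; symmetry; auto).
rewrite (RInt_ext (fun t => th t * z' t * z t - _) f0 0 T) in Hopt by (intros; unfold f0; simpl; ring).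
replace (RInt (fun t => th t * x' t * x t - et t * x' t ^ 2) 0 T)
  with (RInt f0 0 T + (e * RInt f1 0 T + e ^ 2 * RInt f2 0 T)) in Hopt; [lra |].
symmetry; apply is_RInt_unique.
apply (is_RInt_ext (fun t => f0 t + (e * f1 t + e ^ 2 * f2 t))).
- intros t _. unfold f0, f1, f2, x, x'; simpl; ring.
- apply (is_RInt_plus (V := R_NormedModule) f0).
  + apply (RInt_correct f0), I0.
  + apply (is_RInt_plus (V := R_NormedModule) (fun t => e * f1 t));
      apply (is_RInt_scal (V := R_NormedModule));
      apply (RInt_correct (V := R_CompleteNormedModule)); assumption.
Qed.

Lemma euler_lagrange (t : R) :
  0 < t < T -> 2 * (et' t * z' t + et t * z'' t) = th' t * z t.
Proof.
(* [P] serves to integrate the [h] term of the first variation by parts, leaving only [h']. *)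
set (P := fun t => 0 + RInt (fun s => th s * z' s) 0 t).
assert (dP : forall t, is_derive P t (th t * z' t)).
{ apply (is_derive_primitive (fun s => th s * z' s)); intros s; continuity_tac. }
assert (P0 : P 0 = 0).
{ unfold P. rewrite RInt_point. unfold zero; simpl; ring. }
set (W := fun t => th t * z t - 2 * et t * z' t - P t).
set (W' := fun t => th' t * z t - 2 * (et' t * z' t + et t * z'' t)).
assert (dW : forall t, is_derive W t (W' t)).
{ intros s. unfold W, W'. derive_tac; ring. }
assert (cW : forall t, continuous W t) by (intros s; continuity_tac).
assert (cW' : forall t, continuous W' t) by (intros s; unfold W'; continuity_tac).
(* Subtracting the mean makes the primitive [h] vanish at [T] as well as at 0. Since [z] is twice
   differentiable with continuous [z''], [W] is C1 and [h] is an admissible C2 perturbation. *)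
set (c := RInt W 0 T / T).
set (h' := fun t => W t - c).
assert (dh' : forall t, is_derive h' t (W' t)).
{ intros s. unfold h'. derive_tac; ring. }
assert (ch' : forall t, continuous h' t) by (intros s; continuity_tac).
set (h := fun t => 0 + RInt h' 0 t).
assert (dh : forall t, is_derive h t (h' t)).
{ apply is_derive_primitive, ch'. }
assert (h0 : h 0 = 0).
{ unfold h. rewrite RInt_point. unfold zero; simpl; ring. }
assert (hT : h T = 0).
{ unfold h. rewrite Rplus_0_l. apply is_RInt_unique.
  replace 0 with (minus (RInt W 0 T) (scal (T - 0) c)) at 2.
  - apply (is_RInt_minus (V := R_NormedModule) W).
    + apply (RInt_correct W), ex_RInt_cont, cW.
    + apply (is_RInt_const (V := R_NormedModule)).
  - unfold minus, plus, opp, scal, c; simpl. unfold mult; simpl. field; lra. }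
pose proof (first_variation_zero h h' W' dh dh' cW' h0 hT) as V.
set (K := fun t => 0 + RInt (fun s => h' s * h' s) 0 t).
assert (dK : forall t, is_derive K t (h' t * h' t)).
{ apply (is_derive_primitive (fun s => h' s * h' s)); intros s; continuity_tac. }
assert (KT : K T = 0).
(* As [W + P = th z - 2 et z'] and [h' = W - c], the derivative of [S] is the integrand of the first
   variation. Its boundary terms with [h] vanish, so the first variation equals [K T], the integral
   of the square of [h']. *)
{ set (S := fun t => P t * h t + c * h t + K t).
  assert (dS : forall t, is_derive S t
    (th t * z' t * h t + (th t * z t - 2 * et t * z' t) * h' t)).
  { intros s. unfold S. derive_tac. unfold h', W. ring. }
  assert (I : RInt (fun t => th t * z' t * h t
    + (th t * z t - 2 * et t * z' t) * h' t) 0 T = S T - S 0).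
  { apply is_RInt_unique, (is_RInt_derive (V := R_CompleteNormedModule) S).
    - intros; apply dS.
    - intros; continuity_tac. }
  rewrite V in I. unfold S in I. rewrite h0, hT in I.
  assert (K0 : K 0 = 0).
  { unfold K. rewrite RInt_point. unfold zero; simpl; ring. }
  rewrite K0 in I. lra. }
intros Ht.
(* [K] is nondecreasing and vanishes at both ends, so [h' = 0]: [W] is constant, and [W' = 0] is the
   Euler-Lagrange equation. *)
assert (E : forall s, 0 < s < T -> h' s = 0).
{ intros s Hs. apply Rsqr_0_uniq.
  apply (nonneg_derivative_zero K (fun s => h' s * h' s) 0 T); auto.
  - intros; apply Rle_0_sqr.
  - intros; continuity_tac.
  - rewrite KT. unfold K. rewrite RInt_point. unfold zero; simpl; ring. }
pose proof (is_derive_open_const h' 0 T t 0 (W' t) Ht E (dh' t)) as E'.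
unfold W' in E'. lra.
Qed.

End EulerLagrange.

(** * Sturm comparison by Picone's identity *)

Lemma sturm_interval_zero (T a k eb : R) (th' et et' z z' z'' : R -> R) :
  0 <= a < T -> 0 <= k -> k * T < PI -> 0 < eb ->
  (forall t, is_derive et t (et' t)) ->
  (forall t, is_derive z t (z' t)) ->
  (forall t, is_derive z' t (z'' t)) ->
  (forall t, a < t < T -> 2 * (et' t * z' t + et t * z'' t) = th' t * z t) ->
  (forall t, a < t < T -> eb <= et t) ->
  (forall t, a < t < T -> - (2 * eb * k ^ 2) <= th' t) ->
  z a = 0 -> z T = 0 ->
  forall t, a <= t <= T -> z t = 0.
Proof.
intros Ha Hk HkT Heb det dz dz' EL Het Hth za zT.
set (c := fun t => cos (k * (t - T / 2))).
set (s := fun t => sin (k * (t - T / 2))).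
assert (cpos : forall t, a <= t <= T -> 0 < c t).
(* The argument of the cosine is at most [k * T / 2 < PI / 2] in absolute value. *)
{ intros t Ht. apply cos_gt_0; nra. }
set (F := fun t => et t * z t * z' t + eb * k * (s t / c t) * z t ^ 2).
(* The value of the derivative of [F] once [(eta z')'] is replaced by
   [th' z / 2]: a sum of nonnegative terms. *)
set (F' := fun t => (th' t / 2 + eb * k ^ 2) * z t ^ 2 + (et t - eb) * z' t ^ 2
  + eb * (z' t + k * (s t / c t) * z t) ^ 2).
(* This form does not use the differential equation, so it holds at the endpoints too and gives
   continuity of [F] there. *)
assert (dF0 : forall t, a <= t <= T -> is_derive F t
  ((et' t * z' t + et t * z'' t) * z t + et t * z' t ^ 2
   + eb * k * (k * (1 + (s t / c t) ^ 2) * z t ^ 2 + 2 * (s t / c t) * z t * z' t))).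
{ intros t Ht. pose proof (cpos t Ht) as Hc. unfold F, s, c in *.
  derive_tac.
  unfold Rminus. field. unfold Rminus in Hc; lra. }
assert (dF : forall t, a < t < T -> is_derive F t (F' t)).
{ intros t Ht. replace (F' t) with
    ((et' t * z' t + et t * z'' t) * z t + et t * z' t ^ 2
   + eb * k * (k * (1 + (s t / c t) ^ 2) * z t ^ 2 + 2 * (s t / c t) * z t * z' t)).
  - apply dF0; lra.
  - replace (et' t * z' t + et t * z'' t) with (th' t * z t / 2)
      by (rewrite <- EL by exact Ht; field).
    unfold F'. field. pose proof (cpos t); lra. }
assert (Fz : forall t, a < t < T -> F' t = 0).
{ apply (nonneg_derivative_zero F F').
  - exact dF.
  - intros t Ht. specialize (Het t Ht). specialize (Hth t Ht). unfold F'.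
    repeat apply Rplus_le_le_0_compat; apply Rmult_le_pos; try apply pow2_ge_0; lra.
  - intros t Ht. apply (ex_derive_continuous F). eexists. apply dF0, Ht.
  - unfold F. rewrite za, zT. ring. }
intros t Ht.
assert (dq : forall x, a <= x <= T ->
  is_derive (fun y => z y / c y) x ((z' x + k * (s x / c x) * z x) / c x)).
{ intros x Hx. pose proof (cpos x Hx) as Hc. unfold s, c in *.
  derive_tac. unfold Rminus. field.
  unfold Rminus in Hc; lra. }
assert (E : z a / c a = z t / c t).
{ apply (zero_derivative_eq (fun y => z y / c y)); [lra | |].
  - intros x Hx. assert (Hx' : a < x < T) by lra.
    replace 0 with ((z' x + k * (s x / c x) * z x) / c x); [apply dq; lra |].
    replace (z' x + k * (s x / c x) * z x) with 0; [unfold Rdiv; ring |].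
    specialize (Fz x Hx'). specialize (Het x Hx'). specialize (Hth x Hx').
    unfold F' in Fz.
    assert (0 <= (th' x / 2 + eb * k ^ 2) * z x ^ 2)
      by (apply Rmult_le_pos; [lra | apply pow2_ge_0]).
    assert (0 <= (et x - eb) * z' x ^ 2)
      by (apply Rmult_le_pos; [lra | apply pow2_ge_0]).
    (* All three terms of [F'] are nonnegative and sum to zero, so the square of [u] vanishes; [u]
       is the numerator of the derivative of [z / c]. *)
    set (u := z' x + k * (s x / c x) * z x) in *.
    assert (0 <= eb * u ^ 2) by (apply Rmult_le_pos; [lra | apply pow2_ge_0]).
    assert (Hu : eb * u ^ 2 = 0) by lra.
    symmetry. apply Rsqr_0_uniq. rewrite Rsqr_pow2.
    apply Rmult_integral in Hu. destruct Hu; lra.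
  - intros x Hx. apply (ex_derive_continuous (fun y => z y / c y)). eexists.
    apply dq; lra. }
rewrite za in E. pose proof (cpos t Ht).
replace (z t) with (z t / c t * c t) by (field; lra).
rewrite <- E. unfold Rdiv; ring.
Qed.

(** * Non-negativity of the optimal strategy *)

Theorem proposition12 (T Q : R) (theta eta : R -> R)
    (eta_bar theta_bar gamma : R)
    (T_pos : 0 < T) (Q_pos : 0 < Q)
    (theta_pos : forall t, Icc 0 T t -> 0 < theta t)
    (eta_pos : forall t, Icc 0 T t -> 0 < eta t)
    (theta_C1 : class_C 1 (Icc 0 T) theta)
    (eta_C1 : class_C 1 (Icc 0 T) eta)
    (eta_bar_min : is_min_on (Icc 0 T) eta eta_bar)
    (theta_bar_max :
      is_max_on (Icc 0 T) (fun t => Rmax (- Derive_on (Icc 0 T) theta t) 0)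
        theta_bar)
    (gamma_def : gamma = theta_bar / (2 * eta_bar))
    (unique_opt : has_unique_optimum T Q theta eta)
    (small : sqrt gamma * T < PI) :
  forall zeta, is_optimal T Q theta eta zeta ->
    forall t, Icc 0 T t -> 0 <= zeta t.
Proof.
intros zeta opt t It.
destruct (Rle_dec 0 (zeta t)) as [H | Neg]; [exact H | exfalso].
destruct (class_C1_extend 0 T theta T_pos theta_C1) as (th & th' & dth & cth & Eth).
destruct (class_C1_extend 0 T eta T_pos eta_C1) as (et & et' & det & cet & Eet).
pose proof opt as [[zeta_C2 [Z0 ZT]] _].
destruct (class_C2_extend 0 T zeta T_pos zeta_C2) as (z & z' & z'' & dz & dz' & cz & Ez).
assert (EL : forall s, 0 < s < T -> 2 * (et' s * z' s + et s * z'' s) = th' s * z s).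
{ apply (euler_lagrange T Q theta eta zeta th th' et et' z z' z''); auto;
    intros s Hs; [apply Eth | apply Eet | apply Ez]; exact Hs. }
destruct eta_bar_min as [[tm [Itm Etm]] Hmin].
destruct theta_bar_max as [[tM [ItM EtM]] Hmax].
assert (eb_pos : 0 < eta_bar) by (rewrite <- Etm; auto).
assert (tb_pos : 0 <= theta_bar) by (rewrite <- EtM; apply Rmax_r).
assert (g_pos : 0 <= gamma).
{ rewrite gamma_def. apply Rdiv_le_0_compat; lra. }
assert (zt : z t < 0) by (rewrite (proj1 (Ez t It)); lra).
assert (z0 : z 0 = Q) by (rewrite (proj1 (Ez 0 ltac:(unfold Icc; lra))); exact Z0).
assert (zT : z T = 0) by (rewrite (proj1 (Ez T ltac:(unfold Icc; lra))); exact ZT).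
(* The sign change from [z 0 = Q > 0] to [z t < 0] gives a zero [a] before [t]. The comparison on
   [[a, T]] then forces [z t = 0], a contradiction. *)
destruct (IVT_gen z 0 t 0) as (a & Ha & za).
{ intros x. apply continuity_pt_filterlim.
  apply (ex_derive_continuous z). eexists. apply dz. }
{ rewrite z0. rewrite Rmin_right, Rmax_left by lra. lra. }
destruct It as [It0 ItT].
rewrite Rmin_left, Rmax_right in Ha by lra.
assert (a <> t) by (intros ->; lra).
assert (z t = 0); [| lra].
apply (sturm_interval_zero T a (sqrt gamma) eta_bar th' et et' z z' z''); auto;
  try lra.
- apply sqrt_pos.
- intros s Hs; apply EL; lra.
- intros s Hs. rewrite (proj1 (Eet s ltac:(unfold Icc; lra))).
  apply Hmin; unfold Icc; lra.
- intros s Hs. assert (Is : Icc 0 T s) by (unfold Icc; lra).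
  (* With [k ^ 2 = gamma], the quantity [2 * eta_bar * k ^ 2] is exactly [theta_bar], which
     dominates the negative part of the derivative of [theta]. *)
  rewrite (proj2 (Eth s Is)), pow2_sqrt by exact g_pos. rewrite gamma_def.
  replace (2 * eta_bar * (theta_bar / (2 * eta_bar))) with theta_bar by (field; lra).
  pose proof (Hmax s Is) as H1. cbv beta in H1.
  pose proof (Rmax_l (- Derive_on (Icc 0 T) theta s) 0). lra.
Qed.
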